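(* Let $N_B, T_B \ge 1$ be integers, $T = N_B T_B$, and let $\boldsymbol{\tau} = (\boldsymbol{\tau}_T, \boldsymbol{\tau}_{T-1}, \dots, \boldsymbol{\tau}_0)$ be a reverse diffusion trajectory of a diffusion language model with reverse policy $\pi_\theta$, where $\boldsymbol{\tau}_T$ is the fully masked sequence and $\boldsymbol{\tau}_0 \in \mathcal{V}^L$. For $s \in \{1,\dots,N_B\}$ and $t \in \{0,1,\dots,T_B\}$ write $\boldsymbol{\tau}_{s,t} := \boldsymbol{\tau}_{(s-1)T_B + t}$ for the state at block $s$ and within-block step $t$. Then the trajectory probability $\pi_\theta(\boldsymbol{\tau})$ satisfies $$\log \pi_\theta(\boldsymbol{\tau}) = \sum_{s=1}^{N_B} \mathbb{E}_{t \sim U(1,T_B)} \Bigl[ T_B \log \pi_\theta(\boldsymbol{\tau}_{s,t-1} \mid \boldsymbol{\tau}_{s,t}, t) \Bigr],$$ where $U(1,T_B)$ is the uniform distribution on $\{1,\dots,T_B\}$.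
   Context: $\mathcal{V}$ is a finite vocabulary, $[\mathbf{M}] \notin \mathcal{V}$ is a special mask token, and $\bar{\mathcal{V}} = \mathcal{V} \cup \{[\mathbf{M}]\}$. States are sequences $\boldsymbol{\tau}_t \in \bar{\mathcal{V}}^L$ of fixed length $L$, indexed by global time $t \in \{0,1,\dots,T\}$; $\tau_t^{(i)}$ is the token at position $i$. Generation runs from $t=T$ (all tokens equal to $[\mathbf{M}]$) down to $t=0$ (no token masked). Masking schedule: $\beta_t \in [0,1]$ for $t = 1,\dots,T$, and $\alpha_t = \prod_{r=1}^t (1-\beta_r)$ with $\alpha_0 = 1$; it is assumed that $\alpha_t < 1$ for $t \ge 1$, so that the coefficients below are defined. Model: for every state $\boldsymbol{\tau}_t$ and every position $i$, the network with parameter $\theta$ gives a categorical distribution $\mu_\theta(\cdot \mid \boldsymbol{\tau}_t)$ over $\mathcal{V}$ at position $i$ (a softmax of logits, so all probabilities are positive). The coordinatewise reverse kernel is $$p_\theta(\tau_{t-1}^{(i)} \mid \tau_t^{(i)}, \boldsymbol{\tau}_t, \mu_\theta) = \begin{cases} \frac{\alpha_{t-1}-\alpha_t}{1-\alpha_t}\, \mu_\theta(\tau_{t-1}^{(i)} \mid \boldsymbol{\tau}_t) & \tau_t^{(i)} = [\mathbf{M}],\ \tau_{t-1}^{(i)} \ne [\mathbf{M}], \\ \frac{1-\alpha_{t-1}}{1-\alpha_t} & \tau_t^{(i)} = [\mathbf{M}],\ \tau_{t-1}^{(i)} = [\mathbf{M}], \\ 1 & \tau_t^{(i)} \ne [\mathbf{M}],\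 \tau_{t-1}^{(i)} = \tau_t^{(i)}, \\ 0 & \text{otherwise,} \end{cases}$$ where $\mu_\theta(\tau_{t-1}^{(i)} \mid \boldsymbol{\tau}_t)$ is the probability of the token $\tau_{t-1}^{(i)}$ at position $i$. Positions are independent: the reverse policy is $\pi_\theta(\boldsymbol{\tau}_{t-1} \mid \boldsymbol{\tau}_t, t) = \prod_{i=1}^L p_\theta(\tau_{t-1}^{(i)} \mid \tau_t^{(i)}, \boldsymbol{\tau}_t, \mu_\theta)$. Everything is implicitly conditioned on a fixed prompt. The trajectory probability is defined by $\pi_\theta(\boldsymbol{\tau}) = \prod_{t=1}^T \pi_\theta(\boldsymbol{\tau}_{t-1} \mid \boldsymbol{\tau}_t, t)$ (the deterministic initial state contributes no factor). The time horizon $\{1,\dots,T\}$ is partitioned into $N_B$ consecutive blocks of $T_B$ steps. The notation $\pi_\theta(\boldsymbol{\tau}_{s,t-1} \mid \boldsymbol{\tau}_{s,t}, t)$ denotes the one-step transition probability of the reverse policy at global time $(s-1)T_B + t$. Logarithms take values in $[-\infty, 0]$ with $\log 0 = -\infty$. *)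

(* Defs.v *)
From HB Require Import structures.
From mathcomp Require Import all_boot all_order all_algebra.
From mathcomp Require Import all_classical all_reals all_analysis.

Set Implicit Arguments.
Unset Strict Implicit.
Unset Printing Implicit Defensive.

Import Order.TTheory GRing.Theory Num.Theory.

Local Open Scope ring_scope.

(* The vocabulary is V and the extended vocabulary is [option V], with [None]
   the mask token.  All times are natural numbers; only the times occurring in
   the hypotheses and conclusions matter, so schedules and trajectories are
   total functions on nat. *)
Definition state (V : Type) (L : nat) := {ffun 'I_L -> option V}.

Definition fully_masked (V : finType) (L : nat) (x : state V L) : Prop :=
  forall i, x i = None.

Definition unmasked (V : finType) (L : nat) (x : state V L) : Prop :=
  forall i, x i <> None.

Definition softmax (R : realType) (V : finType) (l : V -> R) (v : V) : R :=
  expR (l v) / \sum_(w : V) expR (l w).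

Definition alpha (R : realType) (beta : nat -> R) (t : nat) : R :=
  \prod_(1 <= r < t.+1) (1 - beta r).

Section ReversePolicy.
Context {R : realType} {V : finType} {L : nat} {Theta : Type}.
Variables (logits : Theta -> state V L -> 'I_L -> V -> R) (theta : Theta).
Variable beta : nat -> R.

Definition mu (x : state V L) (i : 'I_L) (v : V) : R :=
  softmax (logits theta x i) v.

(* Law of the token at position i at time t - 1, given the state x at time t. *)
Definition reverse_kernel (t : nat) (x : state V L) (i : 'I_L)
    (y : option V) : R :=
  match x i, y with
  | None, Some v =>
      (alpha beta t.-1 - alpha beta t) / (1 - alpha beta t) * mu x i v
  | None, None => (1 - alpha beta t.-1) / (1 - alpha beta t)
  | Some u, Some v => if v == u then 1 else 0
  | Some _, None => 0
  end.

(* [reverse_policy t x y] is the probability of moving from x at time t to y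
   at time t - 1. *)
Definition reverse_policy (t : nat) (x y : state V L) : R :=
  \prod_(i < L) reverse_kernel t x i (y i).

Definition trajectory_prob (T : nat) (tau : nat -> state V L) : R :=
  \prod_(1 <= t < T.+1) reverse_policy t (tau t) (tau t.-1).

End ReversePolicy.

Definition block_time (TB s t : nat) : nat := (s.-1 * TB + t)%N.

Definition block_state (V : finType) (L : nat) (tau : nat -> state V L)
  (TB s t : nat) : state V L := tau (block_time TB s t).

Definition block_policy (R : realType) (V : finType) (L : nat) (Theta : Type)
    (logits : Theta -> state V L -> 'I_L -> V -> R) (theta : Theta)
    (beta : nat -> R) (TB : nat) (tau : nat -> state V L) (s t : nat) : R :=
  reverse_policy logits theta beta (block_time TB s t)
    (block_state tau TB s t) (block_state tau TB s t.-1).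

(* The uniform distribution U(1, n), as a measure on nat; it is a probability
   when n > 0.  Expectations of extended-real functions are integrals against
   it, since the library's ['E_P[X]] only takes real-valued X. *)
Definition uniform_nat (R : realType) (n : nat) : {measure set nat -> \bar R} :=
  mscale (n%:R^-1)%:nng (msum (fun k : nat => \d_k.+1) n).

Lemma uniform_nat1 (R : realType) (n k : nat) :
  uniform_nat R n [set k]%classic =
  (if (1 <= k <= n)%N then n%:R^-1 else 0)%:E.
Proof.
rewrite /uniform_nat /= /mscale /= /msum /=.
case: k => [|k] /=.
  by rewrite big1 ?mule0// => i _; rewrite diracE memNset.
case: ltnP => kn.
  rewrite (bigD1 (Ordinal kn))//= big1 ?adde0 => [|i ik].
    by rewrite diracE mem_set// mule1.
  rewrite diracE memNset//= => -[] e; move/eqP: ik; apply; exact: val_inj.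
rewrite big1 ?mule0// => i _; rewrite diracE memNset//= => -[] e.
by have := ltn_ord i; rewrite e ltnNge kn.
Qed.

Lemma uniform_natT (R : realType) (n : nat) :
  (0 < n)%N -> uniform_nat R n [set: nat]%classic = 1%E.
Proof.
move=> n0; rewrite /uniform_nat /= /mscale /= /msum /=.
under eq_bigr do rewrite diracT.
rewrite sumEFin sumr_const card_ord -EFinM mulVf// pnatr_eq0.
by rewrite -lt0n.
Qed.

(* Main.v *)
(* The trajectory probability is a product of nonnegative one-step transition
   probabilities, so its logarithm is the sum over global times 1, ..., NB * TB
   of the one-step logarithms, also when some factor vanishes.  Grouping that
   sum by blocks, each block sum is TB times an average over U(1, TB). *)
Require Import Defs.
From HB Require Import structures.
From mathcomp Require Import all_boot all_order all_algebra.
From mathcomp Require Import all_classical all_reals all_analysis.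

Set Implicit Arguments.
Unset Strict Implicit.
Unset Printing Implicit Defensive.

Import Order.TTheory GRing.Theory Num.Theory.

Local Open Scope ring_scope.

(** If a factor vanishes, both sides are [-oo], since [-oo] absorbs any summand; otherwise this is
    the logarithm law for positive reals. *)
Lemma lneM_ge0 (R : realType) (x y : R) :
  0 <= x -> 0 <= y -> lne (x * y)%:E = (lne x%:E + lne y%:E)%E.
Proof.
rewrite le_eqVlt => /predU1P[<- _|x0].
  by rewrite mul0r (@le0_lneNy _ 0%E)// addNye.
rewrite le_eqVlt => /predU1P[<-|y0].
  by rewrite mulr0 (@le0_lneNy _ 0%E)// addeNy.
by rewrite EFinM lneM// in_itv/= leey andbT lte_fin.
Qed.

Lemma lne_prod (R : realType) (I : Type) (r : seq I) (P : pred I) (F : I -> R) :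
  (forall i, P i -> 0 <= F i) ->
  lne (\prod_(i <- r | P i) F i)%:E = (\sum_(i <- r | P i) lne (F i)%:E)%E.
Proof.
move=> F0; elim: r => [|i r IH]; first by rewrite !big_nil lne1.
rewrite !big_cons; case: ifPn => // Pi.
by rewrite lneM_ge0 ?IH ?F0// prodr_ge0.
Qed.

Lemma lne_EFin_lty (R : realType) (x : R) : (lne x%:E < +oo)%E.
Proof. by rewrite /=; case: ifP => _; rewrite ?ltNyr ?ltry. Qed.

(** The measure is a scaled sum of Dirac masses, and the integral of a nonnegative function is
    linear in the measure. *)
Lemma ge0_integral_uniform_nat (R : realType) (n : nat) (f : nat -> \bar R) :
  (forall k, 0 <= f k)%E ->
  (\int[uniform_nat R n]_k f k = (n%:R^-1)%:E * \sum_(1 <= k < n.+1) f k)%E.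
Proof.
move=> f0; rewrite ge0_integral_mscale// ge0_integral_measure_sum//.
(* The masses sit at [k.+1] for [k < n], hence the shift of the range. *)
congr (_ * _)%E; rewrite big_add1 big_mkord; apply: eq_bigr => k _.
by rewrite integral_dirac// diracT mul1e.
Qed.

(* Finiteness from above on the support excludes the indeterminate form +oo - oo
   between the positive and negative parts. *)
Lemma integral_uniform_nat (R : realType) (n : nat) (f : nat -> \bar R) :
  (forall k, (1 <= k <= n)%N -> f k < +oo)%E ->
  (\int[uniform_nat R n]_k f k = (n%:R^-1)%:E * \sum_(1 <= k < n.+1) f k)%E.
Proof.
move=> foo; rewrite integralE !ge0_integral_uniform_nat//.
have pos_fin : (\sum_(1 <= k < n.+1) f^\+ k)%E \is a fin_num.
  apply/sum_fin_numP => k; rewrite mem_index_iota ltnS => kn _.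
  by rewrite ge0_fin_numE// funeposE gt_max foo ?ltry.
rewrite -muleBr ?fin_num_adde_defr//.
congr (_ * _)%E; rewrite -sumeN => [|i j _ _]; last first.
  by rewrite ge0_adde_def// inE.
by rewrite -big_split; apply: eq_bigr => k _; rewrite [in RHS](funeposneg f).
Qed.

Lemma uniform_nat_mean (R : realType) (n : nat) (f : nat -> \bar R) :
  (0 < n)%N -> (forall k, f k < +oo)%E ->
  (\int[uniform_nat R n]_k (n%:R%:E * f k) = \sum_(1 <= k < n.+1) f k)%E.
Proof.
move=> n0 foo; have n0R : (0 < n%:R :> R) by rewrite ltr0n.
rewrite integral_uniform_nat => [|k _]; last first.
  (* Scaling by [n > 0] keeps [-oo] at [-oo]. *)
  by case: (f k) (foo k) => [r| |] // _; rewrite ?ltry// gt0_muleNy.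
(* The constant distributes over the sum because no value is [+oo], so opposite infinities never
   meet. *)
rewrite -fin_num_sume_distrr// => [|i j _ _]; last first.
  by move: (foo i) (foo j); case: (f i) => [?| |]; case: (f j) => [?| |].
by rewrite muleA -EFinM mulVf ?gt_eqF// mul1e.
Qed.

Lemma softmax_ge0 (R : realType) (V : finType) (l : V -> R) (v : V) :
  0 <= softmax l v.
Proof. by rewrite divr_ge0 ?expR_ge0// sumr_ge0// => w _; exact: expR_ge0. Qed.

Lemma alphaS (R : realType) (beta : nat -> R) (t : nat) :
  alpha beta t.+1 = alpha beta t * (1 - beta t.+1).
Proof. by rewrite /alpha big_nat_recr. Qed.

Lemma alpha0 (R : realType) (beta : nat -> R) : alpha beta 0 = 1.
Proof. by rewrite /alpha big_geq. Qed.

Lemma alpha_ge0 (R : realType) (beta : nat -> R) (t : nat) :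
  (forall r, (1 <= r <= t)%N -> beta r <= 1) -> 0 <= alpha beta t.
Proof.
move=> b1; rewrite /alpha big_nat; apply: prodr_ge0 => r rt.
by rewrite subr_ge0 b1.
Qed.

Lemma reverse_policy_ge0 (R : realType) (V : finType) (L : nat) (Theta : Type)
    (logits : Theta -> state V L -> 'I_L -> V -> R) (theta : Theta)
    (beta : nat -> R) (T t : nat) (x y : state V L) :
  (forall t, (1 <= t <= T)%N -> 0 <= beta t <= 1) ->
  (forall t, (1 <= t <= T)%N -> alpha beta t < 1) ->
  (1 <= t <= T)%N -> 0 <= reverse_policy logits theta beta t x y.
Proof.
move=> hbeta halpha; case: t => // t tT; apply: prodr_ge0 => i _.
have d_ge0 : 0 <= 1 - alpha beta t.+1 by rewrite subr_ge0 ltW ?halpha.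
rewrite /reverse_kernel; case: (x i) (y i) => [u|] [v|] //=.
- by case: ifP.
- apply: mulr_ge0; last exact: softmax_ge0.
  (* The numerator [alpha beta t - alpha beta t.+1] equals [alpha beta t * beta t.+1]. *)
  apply: divr_ge0 => //; rewrite alphaS mulrBr mulr1 subKr.
  have /andP[b0 _] := hbeta _ tT; rewrite mulr_ge0// alpha_ge0// => r /andP[r1 rt].
  by have /andP[] : 0 <= beta r <= 1 by rewrite hbeta// r1 (leq_trans rt)// ltnW.
- apply: divr_ge0 => //; rewrite subr_ge0.
  (* The bound [halpha] starts at time 1; at time 0 the numerator is [1 - 1]. *)
  case: t tT {d_ge0} => [|t] tT; first by rewrite alpha0.
  by rewrite ltW// halpha//= ltnW.
Qed.

Theorem theorem3p1 (R : realType) (V : finType) (L : nat) (Theta : Type)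
    (logits : Theta -> state V L -> 'I_L -> V -> R) (theta : Theta)
    (NB TB T : nat) (beta : nat -> R) (tau : nat -> state V L)
    (hNB : (1 <= NB)%N) (hTB : (1 <= TB)%N) (hT : T = (NB * TB)%N)
    (hbeta : forall t, (1 <= t <= T)%N -> 0 <= beta t <= 1)
    (halpha : forall t, (1 <= t <= T)%N -> alpha beta t < 1)
    (htauT : fully_masked (tau T)) (htau0 : unmasked (tau 0%N)) :
  (lne (trajectory_prob logits theta beta T tau)%:E =
   \sum_(1 <= s < NB.+1)
     \int[uniform_nat R TB]_t
       (TB%:R%:E * lne (block_policy logits theta beta TB tau s t)%:E))%E.
Proof.
(* [big_nat] keeps the range of [t] as a condition, on which the factors are known to be
   nonnegative. *)
rewrite /trajectory_prob big_nat lne_prod => [|t]; last first.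
  exact: reverse_policy_ge0.
(* With all ranges based at 0, block [s] gathers the indices from [s * TB] to [s.+1 * TB], the
   latter excluded. *)
rewrite -big_nat hT !big_add1 /= big_nat_mul; apply: eq_bigr => s _.
rewrite (uniform_nat_mean hTB) => [|k]; last exact: lne_EFin_lty.
(* Translation by [s * TB] turns global times into within-block times. *)
rewrite big_add1 -{1}[(s * TB)%N]add0n big_addn mulSn addnK.
apply: eq_bigr => t _.
by rewrite /block_policy /block_state /block_time/= addnS addnC.
Qed.
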